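(* Let $\mathcal{S}_1$ and $\mathcal{S}_2$ be two descriptional systems (with associated complexity measures $c_1$ and $c_2$) that are effective full trios. If (1) the infiniteness problem for $\mathcal{S}_1$ is not semi-decidable, and (2) the infiniteness problem for $\mathcal{S}_2$ is decidable, then the trade-off between $\mathcal{S}_1$ and $\mathcal{S}_2$ is non-recursive.
   Context: A descriptional system $\mathcal{S}$ is a recursive set of non-empty finite descriptors, such that each descriptor $D\in\mathcal{S}$ describes a formal language $L(D)$, and if $L(D)$ is recursive (recursively enumerable), then there exists an effective procedure to convert $D$ into a Turing machine that decides (semi-decides) $L(D)$. Every descriptional system is taken to be at most recursively enumerable, i.e. all languages it describes are recursively enumerable. Put $\mathscr{L}(\mathcal{S})=\{L(D)\mid D\in\mathcal{S}\}$ and $\mathcal{S}(L)=\{D\in\mathcal{S}\mid L(D)=L\}$. A complexity measure for $\mathcal{S}$ is a total recursive function $c:\mathcal{S}\to\mathbb{N}$ such that for any alphabet $A$, the set of descriptors in $\mathcal{S}$ describing languages over $A$ is recursively enumerable in order of increasing size, and does not contain infinitely many descriptors of the same size. A total function $f:\mathbb{N}\to\mathbb{N}$ with $f(n)\ge n$ is an upper bound for the increase in complexity when changing from a descriptor in $\mathcal{S}_1$ to an equivalent descriptor in $\mathcal{S}_2$ if for all $D_1\in\mathcal{S}_1$ with $L(D_1)\in\mathscr{L}(\mathcal{S}_2)$ there exists $D_2\in\mathcal{S}_2(L(D_1))$ such that $c_2(D_2)\le f(c_1(D_1))$. The trade-off between $\mathcal{S}_1$ and $\mathcal{S}_2$ is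 non-recursive if there is no recursive upper bound. $\mathcal{S}$ is effectively closed under a language operation if there is an effective construction that, given descriptors from $\mathcal{S}$ for the arguments, yields a descriptor from $\mathcal{S}$ for the result; it is effectively closed under intersection with regular sets if there is an effective procedure that, given $D\in\mathcal{S}$ and a regular language $R$, constructs a descriptor from $\mathcal{S}$ for $L(D)\cap R$. $\mathcal{S}$ is an effective trio if it is effectively closed under $\lambda$-free morphism ($\lambda$ is the empty word), inverse morphism and intersection with regular languages, and an effective full trio if it is also effectively closed under general morphism. As usual, trios are understood to contain a non-empty language, so that $\mathscr{L}(\mathcal{S}_1)\cap\mathscr{L}(\mathcal{S}_2)$ contains all regular languages if both systems are full trios. The infiniteness problem for $\mathcal{S}$ is: given $D\in\mathcal{S}$, is $L(D)$ infinite? *)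

(* Defs.v *)
From mathcomp Require Import all_boot.
From mathcomp Require Import boolp classical_sets functions cardinality.

Set Implicit Arguments.
Unset Strict Implicit.
Unset Printing Implicit Defensive.

Local Open Scope classical_set_scope.

(* Kleene's partial recursive functions of several arguments. *)

Inductive recfun : nat -> Type :=
| Rzero n : recfun n
| Rsucc : recfun 1
| Rproj n (i : 'I_n) : recfun n
| Rcomp m n (g : recfun m) (h : 'I_m -> recfun n) : recfun n
| Rprec n (g : recfun n) (h : recfun n.+2) : recfun n.+1
| Rmu n (g : recfun n.+1) : recfun n.

(* [eval f v y]: f is defined at v, with value y. *)
Fixpoint eval n (f : recfun n) : n.-tuple nat -> nat -> Prop :=
  match f in recfun n return n.-tuple nat -> nat -> Prop with
  | Rzero _ => fun _ y => y = 0
  | Rsucc => fun v y => y = (tnth v ord0).+1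
  | Rproj _ i => fun v y => y = tnth v i
  | Rcomp m _ g h => fun v y =>
      exists u : m.-tuple nat, (forall i, eval (h i) v (tnth u i)) /\ eval g u y
  | Rprec n g h => fun v =>
      let fix rec k y :=
        if k is j.+1 then
          exists z, rec j z /\ eval h [tuple of j :: z :: behead v] y
        else eval g [tuple of behead v] y
      in rec (thead v)
  | Rmu _ g => fun v y =>
      eval g [tuple of y :: v] 0 /\
      forall k, k < y -> exists z, eval g [tuple of k :: v] z.+1
  end.

(* Finite objects are coded by natural numbers through [pickle], used only at
   types built from nat, bool, pairs and sequences: there it is the identity on
   nat, 0/1 on bool, CodeSeq.code of the list of the two codes on a pair, and
   CodeSeq.code of the list of codes on a sequence. *)
Definition computes (T U : countType) (f : recfun 1) (x : T) (y : U) : Prop :=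
  eval f [tuple pickle x] (pickle y).

Definition halts (T : countType) (f : recfun 1) (x : T) : Prop :=
  exists n : nat, eval f [tuple pickle x] n.

(* Problems and procedures on T restricted to the instances in P; nothing is
   required of f outside P. *)
Definition recursive_on (T U : countType) (P : set T) (g : T -> U) : Prop :=
  exists f, forall x, P x -> computes f x (g x).

Definition effectively (T U : countType) (P : set T)
    (spec : T -> U -> Prop) : Prop :=
  exists f, forall x, P x -> exists y, computes f x y /\ spec x y.

Definition decidable_on (T : countType) (P Q : set T) : Prop :=
  exists f, forall x, P x ->
    (Q x -> computes f x true) /\ (~ Q x -> computes f x false).

Definition semi_decidable_on (T : countType) (P Q : set T) : Prop :=
  exists f, forall x, P x -> (Q x <-> halts f x).

Definition recursive_set (T : countType) (Q : set T) : Prop :=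
  decidable_on setT Q.

(* Symbols are natural numbers; an alphabet, i.e. a non-empty finite set of
   symbols, is represented by its strictly increasing list. *)
Definition word := seq nat.
Definition alphabet := seq nat.

Definition is_alphabet (A : alphabet) : Prop := sorted ltn A /\ A <> [::].

Definition words_over (A : alphabet) : set word := [set w | {subset w <= A}].

(* A formal language is a language over a specified alphabet, and equality of
   languages includes equality of the alphabets.  The set of words alone does
   not serve: the descriptors D with L(D) included in A^* are not recursively
   enumerable for systems, such as Turing machines, with undecidable emptiness. *)
Record language := Language { alph : alphabet; words : set word }.

Definition is_language (L : language) : Prop :=
  is_alphabet (alph L) /\ words L `<=` words_over (alph L).

Definition lookup (K : eqType) (V : Type) (s : seq (K * V)) (k : K) : option V :=
  ohead [seq p.2 | p <- s & p.1 == k].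

(* Deterministic Turing machines with one two-way infinite tape, consisting of
   an input alphabet and a list of instructions: ((q, a), (q', b, d)) says that
   in state q on symbol a the machine writes b, enters q' and moves right if d,
   left otherwise; if several instructions apply, the first one is executed.
   The initial state is 0, the accepting state is 1, and the machine stops when
   no instruction applies.  The tape symbol 0 is the blank, and a.+1 stands for
   the letter a. *)
Definition turing_machine :=
  (alphabet * seq ((nat * nat) * (nat * nat * bool)))%type.

(* (state, (tape left of the head, nearest cell first;
            tape from the head cell on)), both ends padded with blanks *)
Definition config := (nat * (seq nat * seq nat))%type.

Definition tm_init (w : word) : config := (0, ([::], [seq a.+1 | a <- w])).

Definition tm_step (M : turing_machine) (c : config) : option config :=
  let: (q, (l, r)) := c in
  if lookup M.2 (q, head 0 r) is Some (q', b, d) then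
    Some (if d then (q', (b :: l, behead r))
          else (q', (behead l, head 0 l :: b :: behead r)))
  else None.

Definition tm_stops_in (M : turing_machine) (w : word) (c : config) : Prop :=
  tm_step M c = None /\
  exists n, iter n (obind (tm_step M)) (Some (tm_init w)) = Some c.

Definition tm_accepts (M : turing_machine) (w : word) : Prop :=
  exists c, tm_stops_in M w c /\ c.1 = 1.

Definition tm_semi_decides (M : turing_machine) (L : language) : Prop :=
  M.1 = alph L /\
  forall w, words_over M.1 w -> (words L w <-> tm_accepts M w).

Definition tm_decides (M : turing_machine) (L : language) : Prop :=
  tm_semi_decides M L /\
  forall w, words_over M.1 w -> exists c, tm_stops_in M w c.

Definition re_language (L : language) : Prop := exists M, tm_semi_decides M L.
Definition recursive_language (L : language) : Prop := exists M, tm_decides M L.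

(* Nondeterministic finite automata: transition triples (q, a, q') and final
   states; the initial state is 0. *)
Definition automaton := (seq (nat * nat * nat) * seq nat)%type.

Fixpoint nfa_run (delta : seq (nat * nat * nat)) (F : seq nat)
    (q : nat) (w : word) : bool :=
  if w is a :: w' then
    has (fun t => (t.1 == (q, a)) && nfa_run delta F t.2 w') delta
  else q \in F.

Definition nfa_words (R : automaton) : set word := [set w | nfa_run R.1 R.2 0 w].

(* A morphism A^* -> B^* is given by the table of the images of the letters of
   A, together with B. *)
Definition morphism := (seq (nat * word) * alphabet)%type.

Definition mdom (h : morphism) : alphabet := unzip1 h.1.
Definition mcod (h : morphism) : alphabet := h.2.

Definition is_morphism (h : morphism) : Prop :=
  [/\ is_alphabet (mdom h), is_alphabet (mcod h) &
      forall p, p \in h.1 -> words_over (mcod h) p.2].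

Definition lambda_free (h : morphism) : Prop :=
  forall p, p \in h.1 -> p.2 <> [::].

Definition mapply (h : morphism) (w : word) : word :=
  flatten [seq odflt [::] (lookup h.1 a) | a <- w].

(* Descriptors are non-empty strings; [lang] is irrelevant off [descriptor]. *)
Record descriptional_system := DescriptionalSystem {
  descriptor : set word;
  lang : word -> language;
  descriptor_recursive : recursive_set descriptor;
  descriptor_nonempty : forall D, descriptor D -> D <> [::];
  lang_formal : forall D, descriptor D -> is_language (lang D);
  lang_re : forall D, descriptor D -> re_language (lang D);
  (* The two conversions to Turing machines are conditions on the system as a
     whole: a system of arbitrary Turing machines describes recursive languages
     too, but provides no deciders for them. *)
  lang_to_decider :
    (forall D, descriptor D -> recursive_language (lang D)) ->
    effectively descriptor (fun D M => tm_decides M (lang D));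
  lang_to_semi_decider :
    (forall D, descriptor D -> re_language (lang D)) ->
    effectively descriptor (fun D M => tm_semi_decides M (lang D))
}.

Definition describing (S : descriptional_system) (L : language) : set word :=
  [set D | descriptor S D /\ lang S D = L].

Definition language_family (S : descriptional_system) : set language :=
  [set lang S D | D in descriptor S].

(* e enumerates X, as a finite or infinite list with possible repetitions, in
   order of increasing c. *)
Definition enumerates_by (X : set word) (c : word -> nat) (e : recfun 1) : Prop :=
  [/\ forall D, X D <-> exists n : nat, computes e n D,
      forall m n : nat, m <= n -> halts e n -> halts e m &
      forall (m n : nat) D D', m <= n -> computes e m D -> computes e n D' ->
        c D <= c D'].

Definition complexity_measure (S : descriptional_system) (c : word -> nat) : Prop :=
  recursive_on (descriptor S) c /\
  forall A : alphabet, is_alphabet A ->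
    let X := [set D | descriptor S D /\ alph (lang S D) = A] in
    (exists e, enumerates_by X c e) /\
    forall n, finite_set [set D | X D /\ c D = n].

Definition upper_bound (S1 S2 : descriptional_system) (c1 c2 : word -> nat)
    (f : nat -> nat) : Prop :=
  (forall n, n <= f n) /\
  forall D1, descriptor S1 D1 -> language_family S2 (lang S1 D1) ->
    exists2 D2, describing S2 (lang S1 D1) D2 & c2 D2 <= f (c1 D1).

Definition non_recursive_tradeoff (S1 S2 : descriptional_system)
    (c1 c2 : word -> nat) : Prop :=
  ~ exists2 f : nat -> nat, recursive_on setT f & upper_bound S1 S2 c1 c2 f.

(* The restriction of the morphisms h to those satisfying P covers both the
   lambda-free and the general case. *)
Definition effectively_closed_morphism (S : descriptional_system)
    (P : set morphism) : Prop :=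
  effectively
    [set x : word * morphism |
      [/\ descriptor S x.1, is_morphism x.2, P x.2 &
          mdom x.2 = alph (lang S x.1)]]
    (fun x D =>
       let: (D1, h) := x in
       describing S (Language (mcod h) (mapply h @` words (lang S D1))) D).

Definition effectively_closed_inverse_morphism (S : descriptional_system) : Prop :=
  effectively
    [set x : word * morphism |
      [/\ descriptor S x.1, is_morphism x.2 & mcod x.2 = alph (lang S x.1)]]
    (fun x D =>
       let: (D1, h) := x in
       describing S
         (Language (mdom h)
            [set w | words_over (mdom h) w /\ words (lang S D1) (mapply h w)]) D).

Definition effectively_closed_regular_intersection
    (S : descriptional_system) : Prop :=
  effectively
    [set x : word * automaton | descriptor S x.1]
    (fun x D =>
       let: (D1, R) := x in
       describing S
         (Language (alph (lang S D1)) (words (lang S D1) `&` nfa_words R)) D).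

Definition effective_trio (S : descriptional_system) : Prop :=
  [/\ exists2 D, descriptor S D & words (lang S D) !=set0,
      effectively_closed_morphism S lambda_free,
      effectively_closed_inverse_morphism S &
      effectively_closed_regular_intersection S].

Definition effective_full_trio (S : descriptional_system) : Prop :=
  effective_trio S /\ effectively_closed_morphism S setT.

(* The instances of the infiniteness problem with a positive answer. *)
Definition infiniteness (S : descriptional_system) : set word :=
  [set D | infinite_set (words (lang S D))].

(* Main.v *)
Require Import Defs.
From mathcomp Require Import all_boot.
From mathcomp Require Import boolp classical_sets functions cardinality.

(* If the trade-off had a recursive bound f, infiniteness would be semi-decidable
   for S1.  Mapping every letter to 0 preserves infiniteness, and turns D into a
   descriptor U of a unary language.  Let B = f (c1 U).  If L(U) is finite, it
   is described by some D2 in S2 with c2 D2 <= B, and such a D2 occurs among the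
   first K descriptors over {0} enumerated in order of increasing c2, for any K
   whose K-th descriptor has size above B.  Hence L(U) is infinite if and only
   if, for some such K and some n, the word 0^n is accepted by the machine for
   L(U) but lies in none of the finite languages among those K: if L(U) is
   infinite, a long enough word of it will do.  Infiniteness is decidable for
   S2, and so is membership of 0^n, because it is the infiniteness of
   h^-1(L) cap 0 1^*, where h maps 0 to 0^n and 1 to the empty word; the search
   for K, n and an accepting run is therefore effective.

   Since [CodeSeq.code] codes lists by iterated cells, [recursive_on] is closed
   under the usual list operations as soon as cells can be built and split. *)

Set Implicit Arguments.
Unset Strict Implicit.
Unset Printing Implicit Defensive.

Local Open Scope classical_set_scope.

(** * Arithmetic with partial recursive functions *)

(** By induction on [f]. For [Rmu], the smaller of two distinct results would give [g] both the
    value zero and a positive value. *)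
Lemma eval_functional n (f : recfun n) v y y' :
  eval f v y -> eval f v y' -> y = y'.
Proof.
elim: n / f v y y' => //=.
- by move=> n v y y' -> ->.
- by move=> v y y' -> ->.
- by move=> n i v y y' -> ->.
- move=> m n g IHg h IHh v y y' [u [hu gu]] [u' [hu' gu']].
  have uu' : u = u'.
    by apply: eq_from_tnth => i; exact: IHh (hu i) (hu' i).
  by rewrite -uu' in gu'; exact: IHg gu gu'.
- move=> n g IHg h IHh v; elim: (thead v) => [|j IHj] y y'; first exact: IHg.
  move=> [z [/IHj rz hz]] [z' [/rz <-]]; exact: IHh hz.
- move=> n g IHg v y y' [gy ly] [gy' ly'].
  case: (ltngtP y y') => // [/ly'|/ly] [z gz].
    by have := IHg _ _ _ gy gz.
  by have := IHg _ _ _ gy' gz.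
Qed.

Lemma eval_app1 n (r : recfun 1) (f : recfun n) v a y :
  eval f v a -> eval r [tuple a] y -> eval (Rcomp r (fun=> f)) v y.
Proof.
move=> fa ra; exists [tuple a]; split => // i.
by rewrite (ord1 i).
Qed.

Definition Rapp2 n (r : recfun 2) (f g : recfun n) : recfun n :=
  Rcomp r (tnth [tuple f; g]).

Lemma eval_app2 n (r : recfun 2) (f g : recfun n) v a b y :
  eval f v a -> eval g v b -> eval r [tuple a; b] y -> eval (Rapp2 r f g) v y.
Proof.
move=> fa gb rab; exists [tuple a; b]; split => //.
by case=> [[|[]]].
Qed.

Definition Rapp3 n (r : recfun 3) (f g h : recfun n) : recfun n :=
  Rcomp r (tnth [tuple f; g; h]).

Lemma eval_app3 n (r : recfun 3) (f g h : recfun n) v a b c y :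
  eval f v a -> eval g v b -> eval h v c -> eval r [tuple a; b; c] y ->
  eval (Rapp3 r f g h) v y.
Proof.
move=> fa gb hc rabc; exists [tuple a; b; c]; split => //.
by case=> [[|[|[]]]].
Qed.

Definition arg n i : recfun n.+1 := Rproj (inord i).

Lemma eval_arg n i (v : n.+1.-tuple nat) y :
  i <= n -> y = nth 0 v i -> eval (arg n i) v y.
Proof. by move=> len ->; rewrite /= (tnth_nth 0) inordK. Qed.

(** [w] is compared with [k :: v] only as a sequence, so that the lemma applies to a tuple however
    it was built. *)
Lemma eval_prec n (g : recfun n) (h : recfun n.+2) v (F : nat -> nat) :
  eval g v (F 0) ->
  (forall j, eval h [tuple of j :: F j :: v] (F j.+1)) ->
  forall k (w : n.+1.-tuple nat), w = k :: v :> seq nat ->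
  eval (Rprec g h) w (F k).
Proof.
move=> g0 hS k w wE; rewrite /=.
have -> : thead w = k by rewrite (tuple_eta w) theadE /thead (tnth_nth 0) wE.
have bw : behead w = v by rewrite wE.
elim: k {wE} => [|k IHk].
  by have -> : [tuple of behead w] = v by exact: val_inj.
exists (F k); split; first exact: IHk.
have -> : [tuple of k :: F k :: behead w] = [tuple of k :: F k :: v].
  by apply: val_inj; rewrite /= bw.
exact: hS.
Qed.

Definition Riter (s : recfun 1) : recfun 2 :=
  Rprec (arg 0 0) (Rcomp s (fun=> arg 2 1)).

Lemma eval_iter (s : recfun 1) (S : nat -> nat) :
  (forall m, eval s [tuple m] (S m)) ->
  forall n m, eval (Riter s) [tuple n; m] (iter n S m).
Proof.
move=> sS n m.
apply: (@eval_prec _ _ _ [tuple m] (fun k => iter k S m)) => // [|j].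
  exact: eval_arg.
by apply: (@eval_app1 _ _ _ _ (iter j S m)); [exact: eval_arg | exact: sS].
Qed.

Definition Radd : recfun 2 := Riter Rsucc.

Lemma eval_add a b : eval Radd [tuple a; b] (a + b).
Proof.
have succP m : eval Rsucc [tuple m] m.+1 by [].
by have := eval_iter succP a b; rewrite iter_succn addnC.
Qed.

Definition Rpred : recfun 1 := Rprec (Rzero 0) (arg 1 0).

Lemma eval_pred a : eval Rpred [tuple a] a.-1.
Proof.
apply: (@eval_prec _ _ _ [tuple] predn) => // j; exact: eval_arg.
Qed.

Definition Rsub : recfun 2 := Rapp2 (Riter Rpred) (arg 1 1) (arg 1 0).

Lemma eval_sub a b : eval Rsub [tuple a; b] (a - b).
Proof.
apply: (@eval_app2 _ _ _ _ _ b a); [exact: eval_arg..|].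
have := eval_iter eval_pred b a; suff -> : iter b predn a = a - b by [].
by elim: b => [|b /= ->]; rewrite ?subn0 ?subnS.
Qed.

(** With integer division, (j + 1) / 2 = j - j / 2: a recursion without a case on parity. *)
Definition Rhalf : recfun 1 :=
  Rprec (Rzero 0) (Rapp2 Rsub (arg 1 0) (arg 1 1)).

Definition Rdouble : recfun 1 := Rapp2 Radd (arg 0 0) (arg 0 0).

Lemma eval_double a : eval Rdouble [tuple a] a.*2.
Proof.
apply: (@eval_app2 _ _ _ _ _ a a); [exact: eval_arg..|].
by rewrite -addnn; exact: eval_add.
Qed.


Lemma eval_half a : eval Rhalf [tuple a] a./2.
Proof.
apply: (@eval_prec _ _ _ [tuple] half) => // j.
apply: (@eval_app2 _ _ _ _ _ j j./2); [exact: eval_arg..|].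
have -> : j.+1./2 = j - j./2.
  by rewrite /= uphalf_half -[X in X - _]odd_double_half -addnn addnA addnK.
exact: eval_sub.
Qed.

Definition Rcond : recfun 3 := Rprec (arg 1 1) (arg 3 2).

Lemma eval_cond a b c : eval Rcond [tuple a; b; c] (if a is 0 then c else b).
Proof.
apply: (@eval_prec _ _ _ [tuple b; c] (fun a => if a is 0 then c else b)) => //.
  exact: eval_arg.
by move=> j; exact: eval_arg.
Qed.

(** * Building and splitting the cells of list codes *)

(** Odd numbers are fixed points, so iteration strips the factors 2 of a positive number and excess
    steps do no harm. *)
Definition halve_even a := if odd a then a else a./2.

Definition Rhalve_even : recfun 1 :=
  Rapp3 Rcond
    (Rapp2 Rsub (arg 0 0) (Rcomp Rdouble (fun=> Rhalf))) (arg 0 0) Rhalf.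

Lemma eval_halve_even a : eval Rhalve_even [tuple a] (halve_even a).
Proof.
have ha := eval_half a.
apply: (@eval_app3 _ _ _ _ _ _ (odd a) a a./2) => //; first 2 last.
- by rewrite /halve_even; have := eval_cond (odd a) a a./2; case: (odd a).
- apply: (@eval_app2 _ _ _ _ _ a a./2.*2); first exact: eval_arg.
    exact: eval_app1 ha (eval_double _).
  have -> : nat_of_bool (odd a) = a - a./2.*2.
    by rewrite -[X in X - _]odd_double_half addnK.
  exact: eval_sub.
- exact: eval_arg.
Qed.

(* [CodeSeq.code (n :: s)] is [cell n (CodeSeq.code s)]. *)
Definition cell h t := 2 ^ h * t.*2.+1.

Lemma cell_gt0 h t : 0 < cell h t.
Proof. by rewrite muln_gt0 expn_gt0. Qed.

Lemma iter_double h a : iter h double a = 2 ^ h * a.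
Proof. by elim: h => [|h IHh] /=; rewrite ?mul1n // IHh -mul2n expnS mulnA. Qed.

Definition Rcell : recfun 2 :=
  Rapp2 (Riter Rdouble) (arg 1 0)
    (Rcomp Rsucc (fun=> Rcomp Rdouble (fun=> arg 1 1))).

Lemma eval_cell h t : eval Rcell [tuple h; t] (cell h t).
Proof.
apply: (@eval_app2 _ _ _ _ _ h t.*2.+1); first exact: eval_arg.
  apply: (@eval_app1 _ _ _ _ t.*2) => //.
  by apply: (@eval_app1 _ _ _ _ t); [exact: eval_arg | exact: eval_double].
by rewrite /cell -iter_double; exact: (eval_iter eval_double).
Qed.

Lemma iter_halve_even_cell k h t :
  h <= k -> iter k halve_even (cell h t) = t.*2.+1.
Proof.
have odd_fix n : iter n halve_even t.*2.+1 = t.*2.+1.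
  by elim: n => //= n ->; rewrite /halve_even /= odd_double.
elim: h k => [|h IHh] k; first by rewrite /cell mul1n.
case: k => // k /IHh <-; rewrite iterSr /halve_even; congr (iter _ _ _).
by rewrite /cell expnS -mulnA mul2n odd_double doubleK.
Qed.

(** [a] steps are enough because a positive [a] has fewer than [a] factors 2. *)
Definition odd_part a := iter a halve_even a.

Lemma odd_part_cell h t : odd_part (cell h t) = t.*2.+1.
Proof.
apply: iter_halve_even_cell; rewrite /cell -[h]muln1 leq_mul //.
by rewrite muln1 ltnW // ltn_expl.
Qed.

Definition Rodd_part : recfun 1 :=
  Rapp2 (Riter Rhalve_even) (arg 0 0) (arg 0 0).

Lemma eval_odd_part a : eval Rodd_part [tuple a] (odd_part a).
Proof.
apply: (@eval_app2 _ _ _ _ _ a a); [exact: eval_arg..|].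
exact: (eval_iter eval_halve_even).
Qed.

Definition Rtail : recfun 1 := Rcomp Rhalf (fun=> Rodd_part).

Lemma eval_tail h t : eval Rtail [tuple cell h t] t.
Proof.
apply: (eval_app1 (eval_odd_part _)); rewrite odd_part_cell.
have := eval_half t.*2.+1; by rewrite /= uphalf_double.
Qed.

(** The code of the empty list is [0], and its [behead] is empty again. *)
Lemma eval_tail0 : eval Rtail [tuple 0] 0.
Proof. by apply: (eval_app1 (eval_odd_part _)); exact: eval_half 0. Qed.

(* The head of a cell [a] is the least [h] with [a <= 2 ^ h * odd_part a]. *)
Definition Rhead : recfun 1 :=
  Rmu (Rapp2 Rsub (arg 1 1)
        (Rapp2 (Riter Rdouble) (arg 1 0)
               (Rcomp Rodd_part (fun=> arg 1 1)))).

Lemma eval_head_test a h :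
  eval (Rapp2 Rsub (arg 1 1)
        (Rapp2 (Riter Rdouble) (arg 1 0)
               (Rcomp Rodd_part (fun=> arg 1 1)))) [tuple h; a]
    (a - 2 ^ h * odd_part a).
Proof.
apply: (@eval_app2 _ _ _ _ _ a (2 ^ h * odd_part a)); last exact: eval_sub.
  exact: eval_arg.
apply: (@eval_app2 _ _ _ _ _ h (odd_part a)); first exact: eval_arg.
  by apply: (@eval_app1 _ _ _ _ a); [exact: eval_arg | exact: eval_odd_part].
by rewrite -iter_double; exact: (eval_iter eval_double).
Qed.

Lemma eval_head h t : eval Rhead [tuple cell h t] h.
Proof.
have test k := eval_head_test (cell h t) k.
split => [|k ltkh].
  by have := test h; rewrite odd_part_cell subnn.
exists (cell h t - 2 ^ k * odd_part (cell h t)).-1; rewrite prednK //.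
by rewrite odd_part_cell subn_gt0 ltn_mul2r ltn_exp2l.
Qed.

(** Composition is strict: a conditional that returns a default on the empty list still evaluates
    this head, which must therefore be defined at [0]. *)
Lemma eval_head0 : eval Rhead [tuple 0] 0.
Proof. by split => //; have := eval_head_test 0 0; rewrite sub0n. Qed.

Definition Rconst n k : recfun n :=
  iter k (fun r => Rcomp Rsucc (fun=> r)) (Rzero n).

Lemma eval_const n k (v : n.-tuple nat) : eval (Rconst n k) v k.
Proof. by elim: k => [|k IHk] //; exact: eval_app1 IHk _. Qed.

(** * Closure properties of computable functions, and unbounded search *)

Lemma recursive_ext (T U : countType) (P : set T) (f g : T -> U) :
  (forall x, P x -> f x = g x) -> recursive_on P f -> recursive_on P g.
Proof. by move=> fg [r rP]; exists r => x Px; rewrite -fg //; exact: rP. Qed.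

(** The side condition tracks domains, since a procedure is specified only on its admissible
    instances. *)
Lemma recursive_comp (T U V : countType) (P : set T) (Q : set U)
    (g : U -> V) (f : T -> U) :
  recursive_on Q g -> (forall x, P x -> Q (f x)) -> recursive_on P f ->
  recursive_on P (fun x => g (f x)).
Proof.
move=> [r rP] PQ [s sP]; exists (Rcomp r (fun=> s)) => x Px.
exact: (@eval_app1 _ _ _ _ (pickle (f x)) _ (sP x Px) (rP _ (PQ x Px))).
Qed.

Lemma recursive_op2 (T U V W : countType) (r : recfun 2) (g : U -> V -> W)
    (P : set T) (f : T -> U) (h : T -> V) :
  (forall u v, eval r [tuple pickle u; pickle v] (pickle (g u v))) ->
  recursive_on P f -> recursive_on P h ->
  recursive_on P (fun x => g (f x) (h x)).
Proof.
move=> rP [s sP] [t tP]; exists (Rapp2 r s t) => x Px.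
exact: eval_app2 (sP x Px) (tP x Px) (rP _ _).
Qed.

Lemma recursive_id (T : countType) (P : set T) : recursive_on P id.
Proof. by exists (arg 0 0) => x _; exact: eval_arg. Qed.

Lemma recursive_const (T U : countType) (P : set T) (u : U) :
  recursive_on P (fun=> u).
Proof. by exists (Rconst 1 (pickle u)) => x _; exact: eval_const. Qed.

Lemma recursive_pickle (T U : countType) (P : set T) (f : T -> U) :
  recursive_on P f -> recursive_on P (fun x => pickle (f x)).
Proof. by case=> r rP; exists r. Qed.

Lemma pickle_decode n : pickle (CodeSeq.decode n) = n.
Proof.
by rewrite -[RHS]CodeSeq.decodeK; congr CodeSeq.code; exact: map_id.
Qed.

(** Every number is the code of a list of numbers, so decoding leaves the code unchanged and the
    same program serves. *)
Lemma recursive_decode (T : countType) (P : set T) (f : T -> nat) :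
  recursive_on P f -> recursive_on P (fun x => CodeSeq.decode (f x)).
Proof.
by case=> r rP; exists r => x Px; rewrite /computes pickle_decode; exact: rP.
Qed.

Lemma recursive_succ (T : countType) (P : set T) (f : T -> nat) :
  recursive_on P f -> recursive_on P (fun x => (f x).+1).
Proof.
by apply: (@recursive_comp _ _ _ _ setT succn) => //; exists Rsucc.
Qed.

Lemma recursive_subn (T : countType) (P : set T) (f g : T -> nat) :
  recursive_on P f -> recursive_on P g -> recursive_on P (fun x => f x - g x).
Proof.
by apply: (@recursive_op2 _ _ _ _ Rsub subn) => u v; exact: eval_sub.
Qed.

Lemma recursive_cons (T U : countType) (P : set T) (f : T -> U)
    (g : T -> seq U) :
  recursive_on P f -> recursive_on P g -> recursive_on P (fun x => f x :: g x).
Proof.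
by apply: (@recursive_op2 _ _ _ _ Rcell cons) => u v; exact: eval_cell.
Qed.

Definition Rpair n (f g : recfun n) : recfun n :=
  Rapp2 Rcell f (Rapp2 Rcell g (Rzero n)).

Lemma eval_pair (T U : countType) n (f g : recfun n) v (t : T) (u : U) :
  eval f v (pickle t) -> eval g v (pickle u) ->
  eval (Rpair f g) v (pickle (t, u)).
Proof.
move=> ft gu; apply: (@eval_app2 _ _ _ _ _ _ (cell (pickle u) 0) _ ft) => //.
  by apply: (@eval_app2 _ _ _ _ _ _ 0 _ gu) => //; exact: eval_cell.
exact: eval_cell.
Qed.

Lemma recursive_pair (T U V : countType) (P : set T) (f : T -> U) (g : T -> V) :
  recursive_on P f -> recursive_on P g -> recursive_on P (fun x => (f x, g x)).
Proof.
move=> [r rP] [s sP]; exists (Rpair r s) => x Px.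
exact: eval_pair (rP x Px) (sP x Px).
Qed.

Lemma recursive_fst (T U V : countType) (P : set T) (f : T -> U * V) :
  recursive_on P f -> recursive_on P (fun x => (f x).1).
Proof.
apply: (@recursive_comp _ _ _ _ setT fst) => //; exists Rhead => -[u v] _.
exact: eval_head.
Qed.

Lemma recursive_snd (T U V : countType) (P : set T) (f : T -> U * V) :
  recursive_on P f -> recursive_on P (fun x => (f x).2).
Proof.
apply: (@recursive_comp _ _ _ _ setT snd) => //.
exists (Rcomp Rhead (fun=> Rtail)) => -[u v] _.
by apply: eval_app1; [exact: eval_tail | exact: eval_head].
Qed.

Lemma recursive_behead (T U : countType) (P : set T) (f : T -> seq U) :
  recursive_on P f -> recursive_on P (fun x => behead (f x)).
Proof.
apply: (@recursive_comp _ _ _ _ setT behead) => //; exists Rtail => -[|u s] _.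
  exact: eval_tail0.
exact: eval_tail.
Qed.

Lemma pickle_bool (b : bool) : pickle b = b.
Proof. by case: b. Qed.

Lemma recursive_eq0 (T : countType) (P : set T) (f : T -> nat) :
  recursive_on P f -> recursive_on P (fun x => f x == 0).
Proof.
apply: (@recursive_comp _ _ _ _ setT (fun n => n == 0)) => //.
exists (Rapp2 Rsub (Rconst 1 1) (arg 0 0)) => n _.
rewrite /computes pickle_bool.
apply: (@eval_app2 _ _ _ _ _ 1 n); [exact: eval_const | exact: eval_arg |].
by have := eval_sub 1 n; case: n => [|[]].
Qed.

Lemma recursive_if (T U : countType) (P : set T) (b : T -> bool)
    (f g : T -> U) :
  recursive_on P b -> recursive_on P f -> recursive_on P g ->
  recursive_on P (fun x => if b x then f x else g x).
Proof.
move=> [r rP] [s sP] [t tP]; exists (Rapp3 Rcond r s t) => x Px.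
apply: (eval_app3 (rP x Px) (sP x Px) (tP x Px)).
by have := eval_cond (pickle (b x)) (pickle (f x)) (pickle (g x)); case: (b x).
Qed.

Lemma recursive_negb (T : countType) (P : set T) (b : T -> bool) :
  recursive_on P b -> recursive_on P (fun x => ~~ b x).
Proof.
move=> rb.
have := recursive_if rb (recursive_const P false) (recursive_const P true).
by apply: recursive_ext => x _; case: (b x).
Qed.

Lemma recursive_andb (T : countType) (P : set T) (b c : T -> bool) :
  recursive_on P b -> recursive_on P c -> recursive_on P (fun x => b x && c x).
Proof.
by move=> rb rc; apply: (recursive_if rb rc); exact: recursive_const.
Qed.

Lemma recursive_orb (T : countType) (P : set T) (b c : T -> bool) :
  recursive_on P b -> recursive_on P c -> recursive_on P (fun x => b x || c x).
Proof.
by move=> rb; apply: (recursive_if rb); exact: recursive_const.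
Qed.

Lemma recursive_leq (T : countType) (P : set T) (f g : T -> nat) :
  recursive_on P f -> recursive_on P g -> recursive_on P (fun x => f x <= g x).
Proof. by move=> rf rg; apply: recursive_eq0; exact: recursive_subn. Qed.

Lemma recursive_eq (T U : countType) (P : set T) (f g : T -> U) :
  recursive_on P f -> recursive_on P g -> recursive_on P (fun x => f x == g x).
Proof.
move=> /recursive_pickle rf /recursive_pickle rg.
have := recursive_andb (recursive_leq rf rg) (recursive_leq rg rf).
apply: recursive_ext => x _.
by rewrite -eqn_leq (inj_eq (pcan_inj pickleK)).
Qed.

Lemma recursive_head (T U : countType) (P : set T) (u : U) (f : T -> seq U) :
  recursive_on P f -> recursive_on P (fun x => head u (f x)).
Proof.
apply: (@recursive_comp _ _ _ _ setT (head u)) => //.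
exists (Rapp3 Rcond (arg 0 0) Rhead (Rconst 1 (pickle u))) => -[|v s] _.
  apply: (@eval_app3 _ _ _ _ _ _ 0 0 (pickle u)).
  - exact: eval_arg.
  - exact: eval_head0.
  - exact: eval_const.
  - exact: eval_cond 0 0 _.
apply: (@eval_app3 _ _ _ _ _ _ (pickle (v :: s)) (pickle v) (pickle u)).
- exact: eval_arg.
- exact: eval_head.
- exact: eval_const.
have := eval_cond (pickle (v :: s)) (pickle v) (pickle u).
have : 0 < pickle (v :: s) by exact: cell_gt0.
by case: (pickle (v :: s)).
Qed.

Lemma recursive_iter (T S : countType) (P : set T) (n : T -> nat)
    (init : T -> S) (step : T * S -> S) :
  recursive_on P n -> recursive_on P init ->
  recursive_on [set z | P z.1] step ->
  recursive_on P (fun x => iter (n x) (fun s => step (x, s)) (init x)).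
Proof.
move=> [rn rnP] [ri riP] [rs rsP].
pose rstep := Rcomp rs (fun=> Rpair (arg 2 2) (arg 2 1)).
exists (Rapp2 (Rprec ri rstep) rn (arg 0 0)).
move=> x Px; apply: (@eval_app2 _ _ _ _ _ _ (pickle x) _ (rnP x Px)).
  exact: eval_arg.
apply: (@eval_prec _ _ _ [tuple pickle x]
  (fun k => pickle (iter k (fun s => step (x, s)) (init x)))) => //.
  exact: riP.
move=> j; pose s := iter j (fun s => step (x, s)) (init x).
apply: (@eval_app1 _ _ _ _ (pickle (x, s))); last exact: (rsP (x, s)).
by apply: eval_pair; exact: eval_arg.
Qed.

(** Lets the code of a list, which is at hand, serve as the number of steps of a traversal. *)
Lemma size_leq_pickle (T : countType) (s : seq T) : size s <= pickle s.
Proof.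
elim: s => //= u s IHs; rewrite -[pickle _]/(cell (pickle u) (pickle s)).
rewrite (leq_ltn_trans IHs) // /cell (@leq_trans (pickle s).*2.+1) //.
  by rewrite ltnS -addnn leq_addr.
by rewrite leq_pmull // expn_gt0.
Qed.

(** The state pairs the remaining list with the accumulator. It is stationary once the list is
    exhausted, so too many steps are harmless. *)
Definition foldl_step (U V : Type) (g : U -> V -> V) (z : seq U * V) :
    seq U * V :=
  if z.1 is u :: s then (s, g u z.2) else z.

Lemma iter_foldl_step (U V : Type) (g : U -> V -> V) s a n : size s <= n ->
  iter n (foldl_step g) (s, a) = ([::], foldl (fun v u => g u v) a s).
Proof.
elim: n s a => [|n IHn] [|u s] a //= les; first by rewrite IHn.
by rewrite -iterS iterSr IHn.
Qed.

Lemma recursive_foldl (T U V : countType) (P : set T) (s : T -> seq U)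
    (a : T -> V) (g : T * (U * V) -> V) :
  recursive_on P s -> recursive_on P a -> recursive_on [set z | P z.1] g ->
  recursive_on P (fun x => foldl (fun v u => g (x, (u, v))) (a x) (s x)).
Proof.
move=> rs ra rg.
pose step (z : T * (seq U * V)) := foldl_step (fun u v => g (z.1, (u, v))) z.2.
have rstep : recursive_on [set z | P z.1] step.
  (* [head] requires a default in [U]. If [U] is empty, every list is empty and the step is the
     identity on states. *)
  have [u0|no_u] := pselect (inhabited U); last first.
    apply: (@recursive_ext _ _ _ snd); last exact/recursive_snd/recursive_id.
    by move=> [x [[|u s'] v]] //; case: no_u.
  have {u0} u0 : U by apply: (@xchoose U xpredT); case: u0 => u; exists u.
  have rz := recursive_id [set z : T * (seq U * V) | P z.1].
  have rl := recursive_fst (recursive_snd rz).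
  have rv := recursive_snd (recursive_snd rz).
  have rh : recursive_on [set z : T * (seq U * V) | P z.1]
      (fun z => g (z.1, (head u0 z.2.1, z.2.2))).
    apply: recursive_comp rg _ _ => //.
    apply: recursive_pair (recursive_fst rz) _.
    exact: recursive_pair (recursive_head u0 rl) rv.
  have := recursive_if (recursive_eq rl (recursive_const _ [::]))
            (recursive_snd rz) (recursive_pair (recursive_behead rl) rh).
  by apply: recursive_ext => -[x [[|u s'] v]].
have := recursive_snd
  (recursive_iter (recursive_pickle rs) (recursive_pair rs ra) rstep).
apply: recursive_ext => x _ /=.
by rewrite (iter_foldl_step (fun u v => g (x, (u, v)))) ?size_leq_pickle.
Qed.

Lemma recursive_foldr (T U V : countType) (P : set T) (s : T -> seq U)
    (a : T -> V) (g : T * (U * V) -> V) :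
  recursive_on P s -> recursive_on P a -> recursive_on [set z | P z.1] g ->
  recursive_on P (fun x => foldr (fun u v => g (x, (u, v))) (a x) (s x)).
Proof.
move=> rs ra rg.
have rrev : recursive_on P (fun x => rev (s x)).
  have rz := recursive_id [set z : T * (U * seq U) | P z.1].
  have := recursive_foldl rs (recursive_const P [::])
    (recursive_cons (recursive_fst (recursive_snd rz))
                    (recursive_snd (recursive_snd rz))).
  apply: recursive_ext => x _; rewrite /= /rev.
  by elim: (s x) [::] => //= u s' IHs acc; rewrite IHs.
have := recursive_foldl rrev ra rg.
by apply: recursive_ext => x _; rewrite foldl_rev.
Qed.

Lemma recursive_nseq (T U : countType) (P : set T) (n : T -> nat) (u : U) :
  recursive_on P n -> recursive_on P (fun x => nseq (n x) u).
Proof.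
move=> rn; have rz := recursive_id [set z : T * seq U | P z.1].
exact: recursive_iter rn (recursive_const P [::])
  (recursive_cons (recursive_const _ u) (recursive_snd rz)).
Qed.

(** The bounded quantifier is an iteration whose state holds the next index and the conjunction so
    far. *)
Lemma recursive_all_iota (T : countType) (P : set T) (n : T -> nat)
    (b : T * nat -> bool) :
  recursive_on P n -> recursive_on [set z | P z.1] b ->
  recursive_on P (fun x => all (fun k => b (x, k)) (iota 0 (n x))).
Proof.
move=> rn rb; pose S := (nat * bool)%type.
have rz := recursive_id [set z : T * S | P z.1].
have rk := recursive_fst (recursive_snd rz).
have rstep : recursive_on [set z : T * S | P z.1]
    (fun z => (z.2.1.+1, z.2.2 && b (z.1, z.2.1))).
  apply: recursive_pair (recursive_succ rk) _.
  apply: recursive_andb (recursive_snd (recursive_snd rz)) _.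
  apply: recursive_comp rb _ _ => //.
  exact: recursive_pair (recursive_fst rz) rk.
have := recursive_iter rn (recursive_const P ((0, true) : S)) rstep.
move=> /recursive_snd; apply: recursive_ext => x _.
suff -> : forall m, iter m (fun s : S => (s.1.+1, s.2 && b (x, s.1))) (0, true)
    = (m, all (fun k => b (x, k)) (iota 0 m)) by [].
elim=> // m IHm; rewrite iterS IHm.
by rewrite -[m.+1 in RHS]addn1 iotaD all_cat /= andbT addn1.
Qed.

(* Every number codes a list of numbers, so unbounded search may range over
   the latter. *)
Lemma semi_decidable_exists (T : countType) (P : set T)
    (b : T * seq nat -> bool) :
  recursive_on [set z | P z.1] b ->
  semi_decidable_on P [set x | exists s, b (x, s)].
Proof.
move=> rb.
have rz := recursive_id [set z : T * nat | P z.1].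
have : recursive_on [set z : T * nat | P z.1]
    (fun z => ~~ b (z.1, CodeSeq.decode z.2)).
  apply: recursive_negb; apply: recursive_comp rb _ _ => //.
  apply: recursive_pair (recursive_fst rz) _.
  exact: recursive_decode (recursive_snd rz).
(* [Rmu] looks for a zero and puts the searched variable first, hence the negation of [b] and the
   exchange of arguments. *)
move=> [r rP]; pose t := Rcomp r (fun=> Rpair (arg 1 1) (arg 1 0)).
have tP x k : P x ->
    eval t [tuple k; pickle x] (~~ b (x, CodeSeq.decode k)).
  move=> Px; apply: (@eval_app1 _ _ _ _ (pickle (x, k))).
    by apply: eval_pair; exact: eval_arg.
  by rewrite -pickle_bool; exact: (rP (x, k)).
exists (Rmu t) => x Px; split => [[s bs]|[k [tk _]]].
  have /ex_minnP[m bm minm] : exists k, b (x, CodeSeq.decode k).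
    by exists (CodeSeq.code s); rewrite CodeSeq.codeK.
  exists m; split; first by have := tP x m Px; rewrite bm.
  move=> k km; exists 0; have := tP x k Px.
  by case: (boolP (b _)) km => // /minm; rewrite leqNgt => /negbTE ->.
exists (CodeSeq.decode k).
have {}tk : eval t [tuple k; pickle x] 0 by exact: tk.
by have := eval_functional tk (tP x k Px); case: (b _).
Qed.

(** Replaces a procedure by a function, to which the closure lemmas apply. [u] only provides a value
    outside [P]. *)
Lemma effectively_choice (T U : countType) (P : set T) (spec : T -> U -> Prop)
    (u : U) :
  effectively P spec ->
  exists2 g, recursive_on P g & forall x, P x -> spec x (g x).
Proof.
move=> [r rP].
have /choice[g gP] x : exists y, P x -> computes r x y /\ spec x y.
  have [/rP[y ?]|nPx] := pselect (P x); first by exists y.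
  by exists u.
by exists g => [|x /gP[]//]; exists r => x /gP[].
Qed.

Lemma decidable_recursive (T : countType) (P Q : set T) :
  decidable_on P Q -> recursive_on P (fun x => `[< Q x >]).
Proof.
move=> [r rP]; exists r => x /rP[rt rf].
by case: asboolP.
Qed.

Lemma recursive_map (T U V : countType) (P : set T) (h : U -> V)
    (s : T -> seq U) :
  recursive_on setT h -> recursive_on P s ->
  recursive_on P (fun x => [seq h u | u <- s x]).
Proof.
move=> rh rs; have rz := recursive_id [set z : T * (U * seq V) | P z.1].
have ru := recursive_fst (recursive_snd rz).
have rstep : recursive_on [set z : T * (U * seq V) | P z.1]
    (fun z => h z.2.1 :: z.2.2).
  apply: recursive_cons (recursive_snd (recursive_snd rz)).
  exact: recursive_comp rh _ ru.
exact: recursive_foldr rs (recursive_const P [::]) rstep.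
Qed.

(** * Simulation of Turing machines *)

(** The list inside [lookup], which stays within the coded types by avoiding [option]. The machine
    halts exactly when it is empty. *)
Definition tm_applicable (M : turing_machine) (c : config) :=
  [seq p.2 | p <- M.2 & p.1 == (c.1, head 0 c.2.2)].

Lemma tm_stepE M c : tm_step M c =
  if tm_applicable M c is i :: _ then
    Some (if i.2 then (i.1.1, (i.1.2 :: c.2.1, behead c.2.2))
          else (i.1.1, (behead c.2.1, head 0 c.2.1 :: i.1.2 :: behead c.2.2)))
  else None.
Proof.
case: c => q [l r]; rewrite /tm_step /lookup -/(tm_applicable M (q, (l, r))).
by case: tm_applicable => [|[[q' b] d] s].
Qed.

Lemma recursive_tm_applicable (T : countType) (P : set T)
    (M : T -> turing_machine) (c : T -> config) :
  recursive_on P M -> recursive_on P c ->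
  recursive_on P (fun x => tm_applicable (M x) (c x)).
Proof.
move=> rM rc; pose I := (nat * nat * (nat * nat * bool))%type.
pose Z := (T * (I * seq (nat * nat * bool)))%type.
have rz := recursive_id [set z : Z | P z.1].
have rcz : recursive_on [set z : Z | P z.1] (fun z => c z.1).
  exact: recursive_comp rc _ (recursive_fst rz).
have ri := recursive_fst (recursive_snd rz).
have racc := recursive_snd (recursive_snd rz).
have rkey := recursive_pair (recursive_fst rcz)
  (recursive_head 0 (recursive_snd (recursive_snd rcz))).
have rstep := recursive_if (recursive_eq (recursive_fst ri) rkey)
  (recursive_cons (recursive_snd ri) racc) racc.
have := recursive_foldr (recursive_snd rM) (recursive_const P [::]) rstep.
apply: recursive_ext => x _; rewrite /tm_applicable /=.
by elim: (M x).2 => //= p s ->; case: ifP.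
Qed.

(** Idling after the halt makes the step total, so [t] steps simulate any run of length at most
    [t]. *)
Definition tm_next M c := odflt c (tm_step M c).

Lemma recursive_tm_next (T : countType) (P : set T) (M : T -> turing_machine)
    (c : T -> config) :
  recursive_on P M -> recursive_on P c ->
  recursive_on P (fun x => tm_next (M x) (c x)).
Proof.
move=> rM rc; have ra := recursive_tm_applicable rM rc.
(* The default instruction is discarded by the emptiness test below. *)
have ri := recursive_head ((0, 0), false) ra.
have rq := recursive_fst (recursive_fst ri).
have rb := recursive_snd (recursive_fst ri).
have rl := recursive_fst (recursive_snd rc).
have rr := recursive_behead (recursive_snd (recursive_snd rc)).
have rright := recursive_pair rq (recursive_pair (recursive_cons rb rl) rr).
have rleft := recursive_pair rq (recursive_pair (recursive_behead rl)
  (recursive_cons (recursive_head 0 rl) (recursive_cons rb rr))).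
have := recursive_if (recursive_eq ra (recursive_const P [::])) rc
  (recursive_if (recursive_snd ri) rright rleft).
apply: recursive_ext => x _; rewrite /tm_next tm_stepE.
by case: tm_applicable.
Qed.

Definition tm_accepts_within (M : turing_machine) (w : word) (t : nat) : bool :=
  let c := iter t (tm_next M) (tm_init w) in
  (tm_step M c == None) && (c.1 == 1).

Lemma tm_acceptsE M w : tm_accepts M w <-> exists t, tm_accepts_within M w t.
Proof.
split=> [[c [[stop [t tE]] c1]]|[t /andP[/eqP stop /eqP c1]]].
  exists t; rewrite /tm_accepts_within /=.
  suff -> : iter t (tm_next M) (tm_init w) = c.
    by rewrite stop c1 !eqxx.
  elim: t c tE {stop c1} => [c [] //|t IHt c].
  rewrite iterS; case E: (iter t _ _) => [c'|//] /= stepc'.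
  by rewrite (IHt _ E) /tm_next stepc'.
exists (iter t (tm_next M) (tm_init w)); split => //; split => //.
(* [m] counts only the steps made before the halt. *)
elim: t {stop c1} => [|t [m mE]]; first by exists 0.
rewrite iterS; move: (iter t _ _) mE => c mE.
case E: (tm_step M c) => [c'|]; rewrite /tm_next E; last by exists m.
by exists m.+1; rewrite iterS mE.
Qed.

Lemma recursive_tm_accepts_within (T : countType) (P : set T)
    (M : T -> turing_machine) (w : T -> word) (t : T -> nat) :
  recursive_on P M -> recursive_on P w -> recursive_on P t ->
  recursive_on P (fun x => tm_accepts_within (M x) (w x) (t x)).
Proof.
move=> rM rw rt.
have rinit : recursive_on P (fun x => tm_init (w x)).
  apply: recursive_pair (recursive_const P 0) _.
  apply: recursive_pair (recursive_const P [::]) _.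
  exact: recursive_map (recursive_succ (recursive_id setT)) rw.
have rz := recursive_id [set z : T * config | P z.1].
have rMz : recursive_on [set z : T * config | P z.1] (fun z => M z.1).
  exact: recursive_comp rM _ (recursive_fst rz).
have rc := recursive_iter rt rinit (recursive_tm_next rMz (recursive_snd rz)).
have := recursive_andb
  (recursive_eq (recursive_tm_applicable rM rc) (recursive_const P [::]))
  (recursive_eq (recursive_fst rc) (recursive_const P 1)).
apply: recursive_ext => x _; rewrite /tm_accepts_within tm_stepE.
by case: tm_applicable.
Qed.

(** * Unary images, and membership tested through infiniteness *)

Lemma unzip1_const (T U : Type) (s : seq T) (u : U) :
  unzip1 [seq (a, u) | a <- s] = s.
Proof. by elim: s => //= a s ->. Qed.

Definition unary_morphism (A : alphabet) : morphism :=
  ([seq (a, [:: 0]) | a <- A], [:: 0]).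

Lemma is_alphabet1 a : is_alphabet [:: a].
Proof. by []. Qed.

Lemma unary_morphismP A : is_alphabet A -> is_morphism (unary_morphism A).
Proof.
move=> alphA; split=> //=; first by rewrite /mdom unzip1_const.
by move=> p /mapP[a _ ->].
Qed.

Lemma mdom_unary_morphism A : mdom (unary_morphism A) = A.
Proof. by rewrite /mdom unzip1_const. Qed.

Lemma mapply_unary_morphism A w :
  words_over A w -> mapply (unary_morphism A) w = nseq (size w) 0.
Proof.
have lookup_unary a : a \in A -> lookup (unary_morphism A).1 a = Some [:: 0].
  rewrite /lookup /=; elim: A => //= b A IHA.
  by rewrite inE eq_sym; case: eqP => //= _ /IHA.
elim: w => // a w IHw aw.
rewrite -[mapply _ _]/(odflt [::] (lookup _ a) ++ mapply _ w) IHw.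
  by rewrite lookup_unary // aw ?mem_head.
by move=> b bw; apply: aw; rewrite inE bw orbT.
Qed.

Lemma words_over1 a w : words_over [:: a] w -> w = nseq (size w) a.
Proof.
by move=> aw; apply/all_pred1P/allP => b /aw; rewrite inE.
Qed.

Lemma finite_bounded_words A N :
  finite_set [set w | words_over A w /\ size w <= N].
Proof.
elim: N => [|N IHN].
  by apply: sub_finite_set (finite_set1 [::]) => w [_]; rewrite leqn0 => /nilP.
have finA : finite_set [set` A] by by apply/finite_seqP; exists A.
apply: (@sub_finite_set _ _
  ([set [::]] `|` [set a :: w | a in [set` A] & w in _])); last first.
  by rewrite finite_setU; split; [exact: finite_set1 | exact: finite_image2 IHN].
move=> [|a w] [aw szw]; [by left|right].
exists a; first by apply: aw; rewrite mem_head.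
by exists w => //; split => // b bw; apply: aw; rewrite inE bw orbT.
Qed.

Lemma finite_words_bounded (L : set word) :
  finite_set L -> exists N, forall w, L w -> size w < N.
Proof.
move=> /finite_seqP[s ->]; exists (\max_(w <- s) size w).+1 => w ws.
by rewrite ltnS (big_rem w) //= leq_maxl.
Qed.

(** The morphism preserves length. A finite image thus bounds the lengths in [L], and only finitely
    many words over [A] obey such a bound. *)
Lemma infinite_unary_image A (L : set word) : L `<=` words_over A ->
  infinite_set (mapply (unary_morphism A) @` L) <-> infinite_set L.
Proof.
move=> LA; split; apply: contra_not; first exact: finite_image.
move=> /finite_words_bounded[N ltN].
apply: sub_finite_set (finite_bounded_words A N) => w Lw; split; first exact: LA.
rewrite ltnW //; have /ltN : (mapply (unary_morphism A) @` L) (nseq (size w) 0).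
  by exists w; rewrite // mapply_unary_morphism //; exact: LA.
by rewrite size_nseq.
Qed.

Lemma infinite_unary (L : set word) N : L `<=` words_over [:: 0] ->
  infinite_set L -> exists2 n, N <= n & L (nseq n 0).
Proof.
move=> L0; apply: contra_notP => /forall2NP noL.
apply: sub_finite_set (finite_bounded_words [:: 0] N) => w Lw.
split; first exact: L0.
have [//|] := noL (size w).
by move=> /negP; rewrite -ltnNge => /ltnW.
by rewrite -words_over1 //; exact: L0.
Qed.

(* The inverse image of L under [probe_morphism n] meets [0 1^*] in an infinite
   set if [0^n] is in L, and in the empty set otherwise. *)
Definition probe_morphism (n : nat) : morphism :=
  ([:: (0, nseq n 0); (1, [::])], [:: 0]).

Definition probe_automaton : automaton := ([:: (0, 0, 1); (1, 1, 1)], [:: 1]).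

Lemma probe_morphismP n : is_morphism (probe_morphism n).
Proof.
split=> // p; rewrite !inE => /orP[] /eqP -> // a.
by rewrite mem_nseq inE => /andP[].
Qed.

Lemma probe_automatonP w :
  nfa_words probe_automaton w <-> exists j, w = 0 :: nseq j 1.
Proof.
have run1 u : nfa_run probe_automaton.1 [:: 1] 1 u = (u == nseq (size u) 1).
  elim: u => //= a u ->; rewrite orbF !xpair_eqE /=.
  by rewrite eqseq_cons eq_sym.
rewrite /nfa_words /=; split => [|[j ->]]; last first.
  by rewrite /= -/(nfa_run _ _ 1 _) run1 size_nseq eqxx.
case: w => //= a u; rewrite !orbF !xpair_eqE /= -/(nfa_run _ _ 1 _).
by move=> /andP[/eqP <-]; rewrite run1 => /eqP ->; exists (size u).
Qed.

Lemma mapply_probe n j : mapply (probe_morphism n) (0 :: nseq j 1) = nseq n 0.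
Proof.
have erase1 : mapply (probe_morphism n) (nseq j 1) = [::] by elim: j.
by rewrite -[LHS]/(nseq n 0 ++ mapply (probe_morphism n) _) erase1 cats0.
Qed.

Lemma infinite_probe (L : set word) n :
  infinite_set
    ([set w | words_over [:: 0; 1] w /\ L (mapply (probe_morphism n) w)] `&`
     nfa_words probe_automaton) <-> L (nseq n 0).
Proof.
split=> [/infinite_setN0[w [[_ Lw] /probe_automatonP[j wE]]]|Ln].
  by rewrite wE mapply_probe in Lw.
(* The word 0 1^N has length [N.+1], above the supposed bound. *)
move=> /finite_words_bounded[N] /(_ (0 :: nseq N 1)).
rewrite /= size_nseq ltnNge leqnSn => /(_ _)/negP; apply => //.
split; last by apply/probe_automatonP; exists N.
split; last by rewrite mapply_probe.
by move=> a; rewrite inE mem_nseq !inE => /orP[->|/andP[_ ->]]; rewrite ?orbT.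
Qed.

(** * Finite unary languages in a full trio *)

Lemma mapply_erase (h : morphism) w :
  (forall p, p \in h.1 -> p.2 = [::]) -> mapply h w = [::].
Proof.
move=> h_nil; elim: w => //= a w IHw.
rewrite -[LHS]/(odflt [::] (lookup h.1 a) ++ mapply h w) IHw cats0 /lookup.
case E: [seq _ | _ <- _ & _] => [|u s] //=.
have : u \in [seq p.2 | p <- h.1 & p.1 == a] by rewrite E mem_head.
by case/mapP => p; rewrite mem_filter => /andP[_ /h_nil pu] ->.
Qed.

(** Erasing all letters turns a non-empty language into the one containing only the empty word. Its
    inverse image under the morphism erasing 0 is 0^*, and intersecting with a finite automaton for
    [L] leaves [L]. *)
Lemma finite_unary_described (S : descriptional_system) (L : set word) :
  effective_full_trio S -> L `<=` words_over [:: 0] -> finite_set L ->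
  exists D, describing S (Language [:: 0] L) D.
Proof.
move=> [[[D0 SD0 [w0 Lw0]] _ [inv invP] [cap capP]] [mor morP]] L0.
move=> /finite_words_bounded[N ltN].
have [alphA subA] := lang_formal SD0.
set A := alph _ in alphA subA.
have [] := morP (D0, ([seq (a, [::]) | a <- A], [:: 0])).
  split=> //=; last by rewrite /mdom unzip1_const.
  split=> //=; first by rewrite /mdom unzip1_const.
  by move=> p /mapP[a _ ->].
set h := (_, [:: 0]) => D1 [_ [SD1 D1E]].
have h_nil w : mapply h w = [::].
  by apply: mapply_erase => p /mapP[a _ ->].
have [] := invP (D1, ([:: (0, [::])], [:: 0])).
  split=> //=; last by rewrite D1E.
  by split=> // p; rewrite inE => /eqP ->.
move=> D2 [_ [SD2 D2E]].
(* The automaton counts letters: state [n] is reached by 0^n, and is final if this word lies in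
   [L]. *)
pose F := [seq n <- iota 0 N | `[< L (nseq n 0) >]].
pose delta := [seq (i, 0, i.+1) | i <- iota 0 N].
have [] := capP (D2, (delta, F)); first exact: SD2.
move=> D3 [_ [SD3 D3E]]; exists D3; split => //.
rewrite D3E D2E; congr Language.
have run k q : nfa_run delta F q (nseq k 0) = (q + k \in F).
  elim: k q => [|k IHk] q; first by rewrite addn0.
  rewrite /=; apply/hasP/idP => [[t /mapP[i iN ->]]|].
    by rewrite xpair_eqE /= IHk => /andP[/andP[/eqP -> _]]; rewrite addnS.
  (* Final states lie below [N], hence so does [q], and [delta] contains this transition. *)
  move=> qF; exists (q, 0, q.+1); last by rewrite /= eqxx IHk addSnnS.
  apply/mapP; exists q => //; move: qF.
  rewrite mem_filter !mem_iota /= add0n => /andP[_]; apply: leq_ltn_trans.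
  exact: leq_addr.
have nfaE n : nfa_words (delta, F) (nseq n 0) <-> L (nseq n 0).
  rewrite /nfa_words /= run add0n mem_filter mem_iota /= add0n.
  split => [/andP[/asboolP]//|Ln]; apply/andP; split; first exact/asboolP.
  by have := ltN _ Ln; rewrite size_nseq.
apply/seteqP; split => w /=.
  by move=> [[/words_over1 -> _] /nfaE].
move=> Lw; have w0E := words_over1 (L0 _ Lw); split; last first.
  by rewrite w0E; apply/nfaE; rewrite -w0E.
split; first exact: L0.
rewrite D1E /=; exists w0 => //; rewrite h_nil mapply_erase // => p.
by rewrite inE => /eqP ->.
Qed.

(** * Enumeration of unary descriptors by size *)

Definition unary_descriptors (S : descriptional_system) : set word :=
  [set D | descriptor S D /\ alph (lang S D) = [:: 0]].

(** The singletons of the words 0^n are pairwise distinct, and each has a descriptor. *)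
Lemma infinite_unary_descriptors (S : descriptional_system) :
  effective_full_trio S -> infinite_set (unary_descriptors S).
Proof.
move=> trioS finX.
have /choice[g gP] n :
    exists D, describing S (Language [:: 0] [set nseq n 0]) D.
  apply: finite_unary_described => // w -> a.
  by rewrite mem_nseq inE => /andP[].
have g_inj : injective g.
  move=> m n gmn; have [_ mE] := gP m; have [_] := gP n.
  rewrite -gmn mE => -[E].
  have : [set nseq n 0] (nseq m 0) by rewrite -E.
  by move=> /(congr1 size); rewrite !size_nseq.
apply: infinite_nat.
have -> : [set: nat] = g @^-1` unary_descriptors S.
  apply/seteqP; split => // n _; have [SD DE] := gP n.
  by split => //; rewrite DE.
by apply: finite_preimage finX => m n _ _; exact: g_inj.
Qed.

(** Infinitely many descriptors keep the enumeration from stopping, so it is total. Sizes are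
    unbounded because each size occurs finitely often. *)
Lemma unary_enumeration (S : descriptional_system) (c : word -> nat) :
  complexity_measure S c -> effective_full_trio S ->
  exists E : nat -> word,
    [/\ recursive_on setT E,
        forall k, unary_descriptors S (E k),
        forall D, unary_descriptors S D -> exists k, E k = D,
        forall j k, j <= k -> c (E j) <= c (E k) &
        forall B, exists k, B < c (E k)].
Proof.
move=> [_ /(_ _ (is_alphabet1 0))[[e [eX e_down e_incr]] fin_c]] trioS.
have infX := infinite_unary_descriptors trioS.
(* Vacuous where [e] outputs no word, so [E] can be chosen before [e] is known to be total. *)
pose value (n : nat) (D : word) := forall D' : word, computes e n D' -> D = D'.
have /(@choice _ _ value)[E eE] n : exists D, value n D.
  have [[D eD]|no_D] := pselect (exists D : word, computes e n D).
    exists D => D' eD'; apply: (pcan_inj pickleK).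
    exact: eval_functional eD eD'.
  by exists [::] => D' eD'; case: no_D; exists D'.
have EP k : computes e k (E k).
  suff [y ey] : halts e k.
    suff eD : computes e k (CodeSeq.decode y) by rewrite (eE _ _ eD).
    by rewrite /computes pickle_decode.
  apply: contrapT => nhalts; apply: infX.
  apply: sub_finite_set (finite_image E (finite_II k)) => D /eX[n eD].
  exists n; last exact: eE.
  rewrite /= ltnNge; apply/negP => lekn; apply: nhalts.
  by apply: e_down lekn _; exists (pickle D).
exists E; split.
- by exists e => k _; exact: EP.
- by move=> k; apply/eX; exists k.
- by move=> D /eX[k ek]; exists k; exact: eE.
- by move=> j k lejk; exact: e_incr lejk (EP j) (EP k).
move=> B; apply: contrapT => /forallNP leB; apply: infX.
apply: (@sub_finite_set _ _
  (\bigcup_(n in `I_B.+1) [set D | unary_descriptors S D /\ c D = n])).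
  move=> D XD; exists (c D) => //=; rewrite ltnS leqNgt.
  have /eX[k ek] := XD; suff <- : E k = D by exact/negP.
  exact: eE.
by apply: bigcup_finite => // n _; exact: fin_c.
Qed.

(** * Semi-deciding infiniteness from a recursive bound *)

Theorem theorem5 (S1 S2 : descriptional_system) (c1 c2 : word -> nat)
    (c1_measure : complexity_measure S1 c1)
    (c2_measure : complexity_measure S2 c2)
    (S1_full_trio : effective_full_trio S1)
    (S2_full_trio : effective_full_trio S2)
    (S1_infiniteness : ~ semi_decidable_on (descriptor S1) (infiniteness S1))
    (S2_infiniteness : decidable_on (descriptor S2) (infiniteness S2)) :
  non_recursive_tradeoff S1 S2 c1 c2.
Proof.
move=> [f rf [_ f_bound]]; apply: S1_infiniteness.
pose P1 := descriptor S1; pose P2 := descriptor S2.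
have [E [rE XE E_onto E_incr E_unbounded]] :=
  unary_enumeration c2_measure S2_full_trio.
have [mor rmor morP] := effectively_choice [::] S1_full_trio.2.
have [tm rtm tmP] :=
  effectively_choice ([::], [::]) (lang_to_semi_decider (@lang_re S1)).
have [inv rinv invP] : exists2 inv, _ & _ :=
  let: And4 _ _ h _ := S2_full_trio.1 in effectively_choice [::] h.
have [cap rcap capP] : exists2 cap, _ & _ :=
  let: And4 _ _ _ h := S2_full_trio.1 in effectively_choice [::] h.
have rinf := decidable_recursive S2_infiniteness.
have [rc1 _] := c1_measure; have [rc2 _] := c2_measure.
have SE k : descriptor S2 (E k) by have [] := XE k.
(* The alphabet of [D] is read off the machine [tm D], which makes the morphism computable from
   [D]. *)
pose U D := mor (D, unary_morphism (tm D).1).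
have alph_tm D : P1 D -> (tm D).1 = alph (lang S1 D).
  by case/tmP.
have UP D : P1 D -> describing S1
    (Language [:: 0] (mapply (unary_morphism (tm D).1) @` words (lang S1 D)))
    (U D).
  move=> SD; apply: (morP (D, unary_morphism (tm D).1)).
  split=> //=; rewrite ?mdom_unary_morphism ?alph_tm //.
  by apply: unary_morphismP; have [] := lang_formal SD.
have rU : recursive_on P1 U.
  apply: recursive_comp rmor _ _ => [D SD|].
    split=> //=; rewrite ?mdom_unary_morphism ?alph_tm //.
    by apply: unary_morphismP; have [] := lang_formal SD.
  apply: recursive_pair (recursive_id _) _.
  apply: recursive_pair (recursive_const _ _).
  apply: recursive_map (recursive_fst rtm).
  by apply: recursive_pair (recursive_id _) (recursive_const _ _).
have SU D : P1 D -> P1 (U D) by case/UP.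
pose in_lang2 (n k : nat) := `[< infiniteness S2
  (cap (inv (E k, probe_morphism n), probe_automaton)) >].
have in_lang2P n k : in_lang2 n k <-> words (lang S2 (E k)) (nseq n 0).
  have [SDk alphE] := XE k.
  have [SI IE] := invP (E k, probe_morphism n)
    (And3 SDk (probe_morphismP n) (esym alphE)).
  have [SC CE] := capP (inv (E k, probe_morphism n), probe_automaton) SI.
  rewrite -infinite_probe; split => [/asboolP|inf]; last apply/asboolP.
    by rewrite /infiniteness /= CE IE.
  by rewrite /infiniteness /= CE IE.
(* An infinite language cannot equal a finite one, so it is ruled out for every [n]. *)
pose excluded (n k : nat) := `[< infiniteness S2 (E k) >] || ~~ in_lang2 n k.
(* A searched list holds the cut-off [K], the exponent [n] and the running time; missing entries
   count as 0. *)
pose arg0 (s : seq nat) := head 0 s.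
pose arg1 (s : seq nat) := head 0 (behead s).
pose arg2 (s : seq nat) := head 0 (behead (behead s)).
pose test (z : word * seq nat) :=
  [&& f (c1 (U z.1)) < c2 (E (arg0 z.2)),
      all (excluded (arg1 z.2)) (iota 0 (arg0 z.2)) &
      tm_accepts_within (tm (U z.1)) (nseq (arg1 z.2) 0) (arg2 z.2)].
have rtest : recursive_on [set z | P1 z.1] test.
  have rz := recursive_id [set z : word * seq nat | P1 z.1].
  have rs := recursive_snd rz.
  have rU1 : recursive_on [set z : word * seq nat | P1 z.1] (fun z => U z.1).
    by apply: recursive_comp rU _ (recursive_fst rz).
  have rK := recursive_head 0 rs.
  have rn := recursive_head 0 (recursive_behead rs).
  have rt := recursive_head 0 (recursive_behead (recursive_behead rs)).
  apply: recursive_andb; last apply: recursive_andb.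
  - apply: recursive_leq; first apply: recursive_succ.
      apply: (@recursive_comp _ _ _ _ setT f) => //.
      by apply: (@recursive_comp _ _ _ _ P1 c1) => // z /= /SU.
    apply: (@recursive_comp _ _ _ _ P2 c2) => [//|z _|]; first exact: SE.
    exact: (@recursive_comp _ _ _ _ setT E _ rE _ rK).
  - pose b (y : word * seq nat * nat) := excluded (arg1 y.1.2) y.2.
    apply: (@recursive_all_iota _ _ _ b) => //.
    have ry := recursive_id [set y : word * seq nat * nat | P1 y.1.1].
    have rEk : recursive_on [set y : word * seq nat * nat | P1 y.1.1]
        (fun y => E y.2).
      by apply: (@recursive_comp _ _ _ _ setT E) => //; exact: recursive_snd ry.
    have rny :=
      recursive_head 0 (recursive_behead (recursive_snd (recursive_fst ry))).
    apply: recursive_orb; first by apply: recursive_comp rinf _ rEk.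
    (* Each procedure of [S2] is reliable only on its admissible instances, so every intermediate
       result is checked to be one. *)
    apply: recursive_negb; apply: (recursive_comp rinf) => [y _|].
      have [SDk alphE] := XE y.2.
      have [SI _] := invP (E y.2, probe_morphism (arg1 y.1.2))
        (And3 SDk (probe_morphismP _) (esym alphE)).
      by have [] := capP
        (inv (E y.2, probe_morphism (arg1 y.1.2)), probe_automaton) SI.
    apply: (recursive_comp rcap) => [y _|].
      have [SDk alphE] := XE y.2.
      by have [] := invP (E y.2, probe_morphism (arg1 y.1.2))
        (And3 SDk (probe_morphismP _) (esym alphE)).
    apply: recursive_pair (recursive_const _ _).
    apply: (recursive_comp rinv) => [y _|].
      by have [SDk alphE] := XE y.2; split => //; exact: probe_morphismP.
    apply: recursive_pair rEk _.
    apply: recursive_pair (recursive_const _ _).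
    apply: recursive_cons (recursive_const _ _).
    apply: recursive_pair (recursive_const _ _) _.
    exact: recursive_nseq rny.
  - apply: recursive_tm_accepts_within rt => //; last exact: recursive_nseq rn.
    by apply: recursive_comp rtm _ rU1 => z /= /SU.
have [r rP] := semi_decidable_exists rtest; exists r => D SD.
rewrite -(rP D SD) /= /infiniteness /=.
have [_ subA] := lang_formal SD.
rewrite -(@infinite_unary_image (tm D).1); last by rewrite alph_tm.
have [SUD UE] := UP D SD; set L := mapply _ @` _ in UE *.
have L0 : L `<=` words_over [:: 0].
  by have [_] := lang_formal SUD; rewrite UE.
have acceptsP n :
    L (nseq n 0) <-> exists t, tm_accepts_within (tm (U D)) (nseq n 0) t.
  have [tmA tmL] := tmP _ SUD.
  rewrite -tm_acceptsE -tmL; first by rewrite UE.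
  by rewrite tmA UE /= => a; rewrite mem_nseq inE => /andP[].
split => [infL|[s /and3P[]]].
  have [K BK] := E_unbounded (f (c1 (U D))).
  (* [N] is the maximum of the length bounds of the finite languages among the first [K]. *)
  have [N finN] : exists N, forall k n, k < K -> N <= n -> excluded n k.
    elim: K {BK} => [|K [N IHK]]; first by exists 0.
    have [infE|/contrapT finE] := pselect (infiniteness S2 (E K)).
      exists N => k n; rewrite ltnS leq_eqVlt.
      move=> /orP[/eqP -> _|ltkK leNn]; last exact: IHK.
      by rewrite /excluded asboolT.
    have [M ltM] := finite_words_bounded finE.
    exists (maxn N M) => k n; rewrite geq_max ltnS leq_eqVlt.
    move=> /orP[/eqP -> /andP[_ leMn]|ltkK /andP[leNn _]]; last exact: IHK.
    apply/orP; right; apply/negP => /in_lang2P /ltM.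
    by rewrite size_nseq ltnNge leMn.
  have [n leNn Ln] := infinite_unary N L0 infL.
  have /acceptsP[t tP] := Ln.
  exists [:: K; n; t]; rewrite /test /arg0 /arg1 /arg2 /= BK tP andbT.
  by apply/allP => k; rewrite mem_iota => /andP[_ ltkK]; exact: finN.
(* If [L] were finite, it would be the language of some [E k] with [k < K]; but 0^n lies in [L] and
   in no finite language among these. *)
rewrite /=; set K := arg0 s; set n := arg1 s => BK /allP excl tP finL.
have Ln : L (nseq n 0) by apply/acceptsP; exists (arg2 s).
have [D2 D2P] := finite_unary_described S2_full_trio L0 finL.
have [|D3 [SD3 D3E] c2D3] := f_bound (U D) SUD.
  by exists D2; [case: D2P | rewrite UE; case: D2P].
have XD3 : unary_descriptors S2 D3 by split => //; rewrite D3E UE.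
have [k kE] := E_onto _ XD3.
(* Otherwise monotonicity would give [D3] at least the size of [E K], which exceeds the bound. *)
have ltkK : k < K.
  rewrite ltnNge; apply/negP => /E_incr; rewrite kE => /(leq_trans BK).
  by rewrite ltnNge c2D3.
have kK : k \in iota 0 K by rewrite mem_iota.
case/orP: (excl k kK) => [/asboolP|/negP].
  by rewrite /infiniteness /= kE D3E UE.
by apply; apply/in_lang2P; rewrite kE D3E UE.
Qed.
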